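(* Let $\mathcal{M}\subset B(\mathcal{H})$ be a unital operator space and let $\pi:C^*(\mathcal{M})\rightarrow B(\mathcal{H}_\pi)$ be a $*$-representation that is approximately unitarily equivalent to a $*$-representation of $C^*(\mathcal{M})$ with the unique extension property with respect to $\mathcal{M}$. If $\psi:C^*(\mathcal{M})\rightarrow B(\mathcal{H}_\pi)$ is a unital completely positive map satisfying $\psi|_{\mathcal{M}}=\pi|_{\mathcal{M}}$, then there is a net of unitary operators $u_\beta\in B(\mathcal{H}_\pi)$ such that $u_\beta^*\psi(t)u_\beta\rightarrow\pi(t)$ in the weak operator topology for every $t\in C^*(\mathcal{M})$.
   Context: A unital operator space is a linear subspace $\mathcal{M}\subset B(\mathcal{H})$, $\mathcal{H}$ a Hilbert space, containing the identity; $C^*(\mathcal{M})\subset B(\mathcal{H})$ is the $C^*$-algebra it generates. $*$-representations of unital $C^*$-algebras are on Hilbert spaces and are unital. A $*$-representation $\sigma:C^*(\mathcal{M})\to B(\mathcal{H}_\sigma)$ has the unique extension property with respect to $\mathcal{M}$ if, whenever $\psi:C^*(\mathcal{M})\to B(\mathcal{H}_\sigma)$ is unital completely positive with $\psi|_{\mathcal{M}}=\sigma|_{\mathcal{M}}$, then $\psi=\sigma$. Two $*$-representations $\pi,\sigma$ of a $C^*$-algebra $\mathfrak{A}$ are approximately unitarily equivalent if there is a net of unitaries $u_\beta:\mathcal{H}_\sigma\to\mathcal{H}_\pi$ with $\|u_\beta^*\pi(t)u_\beta-\sigma(t)\|\to0$ for each $t\in\mathfrak{A}$. *)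

(* Defs.v *)
From HB Require Import structures.
From mathcomp Require Import all_boot all_order all_algebra.
From mathcomp Require Import all_classical all_reals all_analysis.
From mathcomp Require Import sesquilinear complex.

Set Implicit Arguments.
Unset Strict Implicit.
Unset Printing Implicit Defensive.
Import Order.TTheory GRing.Theory Num.Theory numFieldNormedType.Exports.
Local Open Scope classical_set_scope.
Local Open Scope ring_scope.
Local Open Scope complex_scope.

(* The inner product is linear in its first argument and conjugate-linear in
   the second one; the norm of the normed module is the one it induces. *)
HB.mixin Record CompleteNormedModule_isHilbert (R : realType) (V : Type)
    of CompleteNormedModule R[i] V := {
  inner : {dot V for @Num.conj R[i]};
  sqr_normE : forall x : V, `|x| ^+ 2 = inner x x }.

#[short(type="hilbertType")]
HB.structure Definition Hilbert (R : realType) :=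
  {V of CompleteNormedModule_isHilbert R V & CompleteNormedModule R[i] V}.

Definition bounded_operator (R : realType) (H K : hilbertType R)
    : {pred H -> K} :=
  mem [set f : H -> K |
    linear f /\ exists M : R[i], forall x, `|f x| <= M * `|x|].

Lemma bounded_operator_submod (R : realType) (H K : hilbertType R) :
  submod_closed (@bounded_operator R H K).
Proof.
split.
  apply: mem_set; split; first by move=> a x y; rewrite /= scaler0 addr0.
  by exists 0 => x; rewrite mul0r normr0.
move=> a f g /set_mem[lf [M fM]] /set_mem[lg [N gN]].
apply: mem_set; split.
  move=> b x y; rewrite /= !fctE lf lg !scalerDr !scalerA [b * a]mulrC.
  by rewrite !addrA [X in X + _]addrAC.
exists (`|a| * M + N) => x; rewrite fctE mulrDl -mulrA.
rewrite (le_trans (ler_normD _ _))// lerD// normrZ.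
by rewrite ler_wpM2l.
Qed.

HB.instance Definition _ (R : realType) (H K : hilbertType R) :=
  GRing.isSubmodClosed.Build R[i] (H -> K) (@bounded_operator R H K)
    (@bounded_operator_submod R H K).

Record bop (R : realType) (H K : hilbertType R) : Type := Bop {
  bop_val :> H -> K;
  bopP : bop_val \in @bounded_operator R H K }.

Notation "''B' ( H , K )" := (bop H K)
  (at level 8, format "''B' ( H ,  K )") : type_scope.
Notation "''B' ( H )" := (bop H H)
  (at level 8, format "''B' ( H )") : type_scope.

HB.instance Definition _ (R : realType) (H K : hilbertType R) :=
  [isSub of bop H K for @bop_val R H K].
HB.instance Definition _ (R : realType) (H K : hilbertType R) :=
  [Choice of bop H K by <:].
HB.instance Definition _ (R : realType) (H K : hilbertType R) :=
  [SubChoice_isSubLmodule of bop H K by <:].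

Section BoundedOperators.
Variable R : realType.
Implicit Types H K L : hilbertType R.

Lemma bop_linear H K (T : 'B(H, K)) : linear T.
Proof. by case: T => f /= /set_mem[]. Qed.

Lemma bop_bounded H K (T : 'B(H, K)) :
  exists M : R[i], forall x, `|T x| <= M * `|x|.
Proof. by case: T => f /= /set_mem[]. Qed.

HB.instance Definition _ H K (T : 'B(H, K)) :=
  GRing.isLinear.Build R[i] H K _ T (@bop_linear H K T).

Lemma bop_ext H K (S T : 'B(H, K)) : (forall x, S x = T x) -> S = T.
Proof. by move=> ST; apply/val_inj/funext. Qed.

(* Norms have values in R[i], as in every normed module over R[i], hence the
   real part. *)
Definition opnorm H K (T : 'B(H, K)) : R :=
  sup [set complex.Re `|T x| | x in [set x : H | `|x| <= 1]].

Lemma complexRe_norm H (x : H) : (complex.Re `|x|)%:C = `|x|.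
Proof.
by have := normr_ge0 x; case: (`|x|) => a b; rewrite lecE/= => /andP[/eqP->].
Qed.

Lemma opnorm_has_sup H K (T : 'B(H, K)) :
  has_sup [set complex.Re `|T x| | x in [set x : H | `|x| <= 1]].
Proof.
split; first by exists (complex.Re `|T 0|), 0 => //=; rewrite normr0 ler01.
have [M TM] := bop_bounded T.
exists (complex.Re `|M|) => _ [x /= x1 <-].
suff : `|T x| <= `|M| by rewrite lecE => /andP[].
rewrite (le_trans (TM x))//.
have [->|x0] := eqVneq x 0; first by rewrite normr0 mulr0.
have xp : 0 < `|x| by rewrite normr_gt0.
have M0 : 0 <= M.
  by have := le_trans (normr_ge0 _) (TM x); rewrite pmulr_lge0.
by rewrite (ger0_norm M0) ler_piMr.
Qed.

Lemma opnorm_ub H K (T : 'B(H, K)) x :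
  `|x| <= 1 -> `|T x| <= (opnorm T)%:C.
Proof.
move=> x1; rewrite -complexRe_norm lecR.
by apply: sup_ubound; [case: (opnorm_has_sup T)|exists x].
Qed.

Lemma opnorm_lub H K (T : 'B(H, K)) (M : R) :
  (forall x, `|x| <= 1 -> `|T x| <= M%:C) -> opnorm T <= M.
Proof.
move=> TM; apply: ge_sup; first by case: (opnorm_has_sup T).
by move=> _ [x /= x1 <-]; rewrite -lecR complexRe_norm TM.
Qed.

Lemma opnormP H K (T : 'B(H, K)) x : `|T x| <= (opnorm T)%:C * `|x|.
Proof.
have [->|x0] := eqVneq x 0; first by rewrite linear0 !normr0 mulr0.
have xp : 0 < `|x| by rewrite normr_gt0.
have := @opnorm_ub _ _ T (`|x|^-1 *: x).
rewrite linearZ/= !normrZ ger0_norm ?invr_ge0//.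
rewrite mulVf ?gt_eqF// => /(_ (lexx _)).
by rewrite ler_pdivrMl// mulrC.
Qed.

Lemma opnorm_ge0 H K (T : 'B(H, K)) : 0 <= opnorm T.
Proof.
rewrite -lecR; apply: le_trans (opnorm_ub T (x := 0) _); first exact: normr_ge0.
by rewrite normr0 ler01.
Qed.

Let bop_norm H K (T : 'B(H, K)) : R[i] := (opnorm T)%:C.

Let bop_normD H K (S T : 'B(H, K)) :
  bop_norm (S + T) <= bop_norm S + bop_norm T.
Proof.
rewrite /bop_norm -rmorphD/= lecR; apply: opnorm_lub => x x1.
rewrite rmorphD/= (le_trans (ler_normD _ _))// lerD//; exact: opnorm_ub.
Qed.

Let bop_normZle H K (a : R[i]) (T : 'B(H, K)) :
  bop_norm (a *: T) <= `|a| * bop_norm T.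
Proof.
have aE : (complex.Re `|a|)%:C = `|a|.
  by have := normr_ge0 a; case: (`|a|) => u v; rewrite lecE/= => /andP[/eqP->].
rewrite /bop_norm -aE -rmorphM/= lecR; apply: opnorm_lub => x x1.
by rewrite rmorphM/= aE normrZ ler_wpM2l// opnorm_ub.
Qed.

Let bop_normZ H K (a : R[i]) (T : 'B(H, K)) :
  bop_norm (a *: T) = `|a| * bop_norm T.
Proof.
apply/eqP; rewrite eq_le bop_normZle /=.
have [->|a0] := eqVneq a 0.
  by rewrite normr0 mul0r /bop_norm -[0]/(0%:C) lecR opnorm_ge0.
have -> : bop_norm T = bop_norm (a^-1 *: (a *: T)).
  by rewrite scalerA mulVf// scale1r.
by rewrite -ler_pdivlMl ?normr_gt0// -normfV bop_normZle.
Qed.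

Let bop_norm0_eq0 H K (T : 'B(H, K)) : bop_norm T = 0 -> T = 0.
Proof.
move=> T0; apply: bop_ext => x; apply/eqP.
by rewrite -normr_le0 (le_trans (opnormP T x))// -/(bop_norm T) T0 mul0r.
Qed.

HB.instance Definition _ H K :=
  Lmodule_isNormed.Build R[i] 'B(H, K)
    (@bop_normD H K) (@bop_normZ H K) (@bop_norm0_eq0 H K).

Lemma bop_normE H K (T : 'B(H, K)) : `|T| = (opnorm T)%:C.
Proof. by []. Qed.

Lemma bid_subproof H : idfun \in @bounded_operator R H H.
Proof. by apply: mem_set; split=> //; exists 1 => x; rewrite mul1r. Qed.

Definition bid H : 'B(H) := Bop (bid_subproof H).

Lemma bcomp_subproof H K L (S : 'B(K, L)) (T : 'B(H, K)) :
  S \o T \in @bounded_operator R H L.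
Proof.
apply: mem_set; split; first by move=> a x y; rewrite /= !linearP.
exists ((opnorm S)%:C * (opnorm T)%:C) => x /=.
rewrite (le_trans (opnormP S _))// -mulrA ler_wpM2l ?opnormP//.
by rewrite -[0]/(0%:C) lecR opnorm_ge0.
Qed.

Definition bcomp H K L (S : 'B(K, L)) (T : 'B(H, K)) : 'B(H, L) :=
  Bop (bcomp_subproof S T).

(* Riesz representation makes this set a singleton, so the default value of
   xget is irrelevant. *)
Definition adj H K (T : 'B(H, K)) : 'B(K, H) :=
  xget 0 [set S : 'B(K, H) | forall x y, inner (T x) y = inner x (S y)].

End BoundedOperators.

Arguments bid {R}.

Declare Scope operator_scope.
Delimit Scope operator_scope with op.
Notation "S ∘ T" := (bcomp S T)
  (at level 40, left associativity) : operator_scope.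
Notation "T ^†" := (adj T) (at level 2, format "T ^†") : operator_scope.
Local Open Scope operator_scope.

Section CstarAlgebras.
Variable R : realType.
Implicit Types H K : hilbertType R.

Definition unitary_operator H K (u : 'B(H, K)) : Prop :=
  u^† ∘ u = bid H /\ u ∘ u^† = bid K.

Record Cstar_subalgebra H (A : set 'B(H)) : Prop := {
  Cstar_submod : submod_closed (mem A);
  Cstar_comp : forall S T, A S -> A T -> A (S ∘ T);
  Cstar_adj : forall T, A T -> A T^†;
  Cstar_closed : closed A }.

Definition unital_operator_space H (M : set 'B(H)) : Prop :=
  submod_closed (mem M) /\ M (bid H).

Definition Cstar H (M : set 'B(H)) : set 'B(H) :=
  smallest (@Cstar_subalgebra H) M.

(* A map defined on a set A of operators is represented by a map on 'B(H)
   whose values outside of A are never taken into account. *)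

Definition linear_on H K (A : set 'B(H)) (phi : 'B(H) -> 'B(K)) : Prop :=
  forall (a : R[i]) S T, A S -> A T -> phi (a *: S + T) = a *: phi S + phi T.

Record star_representation H K (A : set 'B(H)) (pi : 'B(H) -> 'B(K)) : Prop := {
  star_rep_linear : linear_on A pi;
  star_rep_unital : pi (bid H) = bid K;
  star_rep_comp : forall S T, A S -> A T -> pi (S ∘ T) = pi S ∘ pi T;
  star_rep_adj : forall T, A T -> pi (T^†) = (pi T)^† }.

(* Positivity of the operator on the Hilbert direct sum of n copies of H that
   is given by the matrix a. In R[i], 0 <= z means that z is real and
   nonnegative. *)
Definition positive_mx H n (a : 'M['B(H)]_n) : Prop :=
  forall x : 'I_n -> H, 0 <= \sum_i \sum_j inner (a i j (x j)) (x i).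

Definition completely_positive H K (A : set 'B(H)) (phi : 'B(H) -> 'B(K)) :
    Prop :=
  forall n (a : 'M['B(H)]_n),
    (forall i j, A (a i j)) -> positive_mx a -> positive_mx (map_mx phi a).

Record ucp H K (A : set 'B(H)) (phi : 'B(H) -> 'B(K)) : Prop := {
  ucp_linear : linear_on A phi;
  ucp_unital : phi (bid H) = bid K;
  ucp_cp : completely_positive A phi }.

Definition unique_extension_property H K (M : set 'B(H))
    (sigma : 'B(H) -> 'B(K)) : Prop :=
  forall psi : 'B(H) -> 'B(K), ucp (Cstar M) psi ->
    {in M, psi =1 sigma} -> {in Cstar M, psi =1 sigma}.

End CstarAlgebras.

Record directedType := DirectedType {
  directed_sort :> Type;
  directed_le : directed_sort -> directed_sort -> Prop;
  directed_refl : forall b, directed_le b b;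
  directed_trans : forall a b c,
    directed_le a b -> directed_le b c -> directed_le a c;
  directed_ub : forall a b, exists c, directed_le a c /\ directed_le b c;
  directed_inh : inhabited directed_sort }.

Definition tails (D : directedType) : set_system D :=
  [set E | exists b0, forall b, directed_le b0 b -> E b].

Arguments tails D : clear implicits.

#[global] Instance tails_filter (D : directedType) : ProperFilter (tails D).
Proof.
split; first by move=> [b /(_ b (directed_refl b))].
split.
- by have [b] := directed_inh D; exists b.
- move=> P Q [a aP] [b bQ]; have [c [ac bc]] := directed_ub a b.
  exists c => d cd; split; first exact/aP/(directed_trans ac).
  exact/bQ/(directed_trans bc).
- by move=> P Q PQ [b bP]; exists b => c /bP /PQ.
Qed.

Section Convergence.
Variable R : realType.
Implicit Types H K : hilbertType R.

Definition approx_unitarily_equiv H K L (A : set 'B(H))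
    (pi : 'B(H) -> 'B(K)) (sigma : 'B(H) -> 'B(L)) : Prop :=
  exists (D : directedType) (u : D -> 'B(L, K)),
    (forall b, unitary_operator (u b)) /\
    forall t, A t ->
      `|(u b)^† ∘ pi t ∘ u b - sigma t| @[b --> tails D] --> (0 : R[i]^o).

Definition WOT_cvg H (D : directedType) (T : D -> 'B(H)) (S : 'B(H)) : Prop :=
  forall x y : H,
    inner (T b x) y @[b --> tails D] --> (inner (S x) y : R[i]^o).

End Convergence.

(* Main.v *)
From HB Require Import structures.
Require Import Defs.
From mathcomp Require Import all_boot all_order all_algebra.
From mathcomp Require Import all_classical all_reals all_analysis.
From mathcomp Require Import sesquilinear complex.
From mathcomp Require Import ring lra.
Import Order.TTheory GRing.Theory Num.Theory numFieldNormedType.Exports.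
Local Open Scope classical_set_scope.
Local Open Scope ring_scope.
Local Open Scope operator_scope.

(* Let v_b be unitaries with v_b^* pi v_b -> sigma pointwise in norm.  The maps
   v_b^* psi v_b are ucp and agree on M with v_b^* pi v_b, so each of their
   point-weak limits along an ultrafilter is a ucp map that extends sigma on M,
   hence is sigma by the unique extension property.  Therefore
   v_b^* psi v_b -> sigma in the point-weak topology.  Given finitely many
   operators t and vectors x, y, one chooses first g with v_g^* pi(t) v_g close
   to sigma(t) in norm, and then b with v_b^* psi(t) v_b close to sigma(t) at
   the vectors v_g^* x, v_g^* y; then u = v_b v_g^* is the required unitary. *)

(** * Order and modulus of complex numbers *)

Section ComplexNumbers.
Local Open Scope complex_scope.
Context {R : realType}.

Lemma complex_gt0P (e : R[i]) : 0 < e -> exists2 r : R, 0 < r & e = r%:C.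
Proof.
move=> e0; have eE : (complex.Re e)%:C = e by rewrite RRe_real// gtr0_real.
by exists (complex.Re e); rewrite // -ltcR eE.
Qed.

(** Comparable elements of [R[i]] have equal imaginary parts. The case e = 1 already forces this
    equality, and what remains is the real statement. *)
Lemma le_epsilon_complex (a b : R[i]) :
  (forall e : R, 0 < e -> a <= b + e%:C) -> a <= b.
Proof.
move=> ab; have := ab 1 ltr01; case: a b ab => [a a'] [b b'] ab.
rewrite !lecE/= => /andP[/eqP e' _]; rewrite addr0 in e'; rewrite e' eqxx/=.
by apply/ler_addgt0Pr => e /ab; rewrite lecE/= => /andP[].
Qed.

Lemma normc_real (x : R) : `|x%:C| = `|x|%:C.
Proof. by rewrite normc_def /= expr0n addr0 sqrtr_sqr. Qed.

Lemma normc_le_Re_Im (z : R[i]) :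
  `|z| <= `|complex.Re z|%:C + `|complex.Im z|%:C.
Proof.
rewrite {1}[z]complexE (le_trans (ler_normD _ _))// normrM !normc_real.
by rewrite [`|'i|]normc_def /= expr0n expr1n add0r sqrtr1 mul1r.
Qed.

End ComplexNumbers.

(** * Inner product geometry: Cauchy-Schwarz and the parallelogram law *)

Section InnerProduct.
Local Open Scope complex_scope.
Context {R : realType} {V : hilbertType R}.
Implicit Types x y z : V.

Lemma innerC x y : inner x y = Num.conj (inner y x).
Proof. by rewrite hermC mul1r. Qed.

Lemma innerDl x y z : inner (x + y) z = inner x z + inner y z.
Proof. exact: linearDl. Qed.

Lemma innerDr x y z : inner x (y + z) = inner x y + inner x z.
Proof. exact: linearDr. Qed.

Lemma innerBl x y z : inner (x - y) z = inner x z - inner y z.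
Proof. exact: linearBl. Qed.

Lemma innerBr x y z : inner x (y - z) = inner x y - inner x z.
Proof. exact: linearBr. Qed.

Lemma innerZl a x y : inner (a *: x) y = a * inner x y.
Proof. exact: linearZl_LR. Qed.

Lemma innerZr a x y : inner x (a *: y) = Num.conj a * inner x y.
Proof. exact: linearZr_LR. Qed.

Lemma inner_injl x y : (forall z, inner x z = inner y z) -> x = y.
Proof.
move=> xy; apply/eqP; rewrite -subr_eq0 -(@dnorm_eq0 _ _ inner) innerBl.
by rewrite xy subrr.
Qed.

Lemma inner_injr x y : (forall z, inner z x = inner z y) -> x = y.
Proof. by move=> xy; apply: inner_injl => z; rewrite innerC xy -innerC. Qed.

(** Pythagoras: the difference of [x] and its projection onto the line of [y] is orthogonal to [y].
    This serves both Cauchy-Schwarz and the orthogonality argument in Riesz representation. *)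
Lemma sqr_norm_sub_proj x y : y != 0 ->
  `|x - (inner x y / inner y y) *: y| ^+ 2 =
  `|x| ^+ 2 - `|inner x y| ^+ 2 / `|y| ^+ 2.
Proof.
move=> y0; have yy0 : inner y y != 0 by rewrite dnorm_eq0.
set a := inner x y / inner y y.
have xya : inner (x - a *: y) y = 0 by rewrite innerBl innerZl divfK// subrr.
rewrite sqr_normE innerBr innerZr xya mulr0 subr0 innerBl innerZl !sqr_normE.
by rewrite normCK [inner y x]innerC /a mulrAC.
Qed.

Lemma cauchy_schwarz x y : `|inner x y| <= `|x| * `|y|.
Proof.
have [->|y0] := eqVneq y 0; first by rewrite linear0r !normr0 mulr0.
rewrite -(@ler_pXn2r _ 2)// ?nnegrE ?mulr_ge0// exprMn.
have := exprn_ge0 2 (normr_ge0 (x - (inner x y / inner y y) *: y)).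
rewrite sqr_norm_sub_proj// subr_ge0 ler_pdivrMr//.
by rewrite exprn_gt0// normr_gt0.
Qed.

Lemma parallelogram x y :
  `|x - y| ^+ 2 + `|x + y| ^+ 2 = 2%:R * `|x| ^+ 2 + 2%:R * `|y| ^+ 2.
Proof.
rewrite !sqr_normE innerBl innerDl !innerBr !innerDr; ring.
Qed.

End InnerProduct.

(** * Riesz representation of bounded functionals *)

Section Riesz.
Local Open Scope complex_scope.
Context {R : realType} {V : hilbertType R}.
Implicit Types x y z : V.

(* By the parallelogram law, the vectors of nearly minimal norm in the affine
   hyperplane f = 1 form a Cauchy filter. *)
Lemma minimal_norm (f : {linear V -> R[i]^o}) (C : R) (x0 : V) :
  (forall x, `|f x| <= C%:C * `|x|) -> f x0 = 1 ->
  exists2 z, f z = 1 & forall x, f x = 1 -> `|z| <= `|x|.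
Proof.
move=> fC fx0.
pose S := [set complex.Re `|x| | x in [set x | f x = 1]].
have normE (x : V) : (complex.Re `|x|)%:C = `|x| by exact: complexRe_norm.
have Sinf : has_inf S.
  split; first by exists (complex.Re `|x0|), x0.
  by exists 0 => _ [x _ <-]; rewrite -ler0c normE.
pose d := inf S.
have d_le x : f x = 1 -> d%:C <= `|x|.
  by move=> fx; rewrite -normE lecR; apply: inf_lbound; [case: Sinf|exists x].
have d_ge0 : 0 <= d.
  apply: lb_le_inf; [by case: Sinf|].
  by move=> _ [x _ <-]; rewrite -ler0c normE.
pose B (e : R) := [set x | f x = 1 /\ `|x| < (d + e)%:C].
have B0 e : 0 < e -> B e !=set0.
  move=> e0; have [_ [x fx <-] xd] := inf_adherent e0 Sinf.
  by exists x; split => //; rewrite -normE ltcR.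
pose F := filter_from [set e : R | 0 < e] B.
have FF : ProperFilter F.
  apply: filter_from_proper; last by move=> e /B0.
  apply: filter_from_filter; first by exists 1 => /=.
  move=> e1 e2 /= e10 e20; exists (Num.min e1 e2).
    by rewrite /= lt_min e10 e20.
  move=> x [fx xd]; split; split => //; apply: lt_le_trans xd _;
    by rewrite lecR lerD2l ge_min lexx ?orbT.
(* The midpoint of [x] and [y] stays in the hyperplane, so the norm of [x + y] is at least 2d; the
   parallelogram law then bounds that of [x - y]. *)
have close (e : R) x y : 0 < e -> B e x -> B e y ->
    `|x - y| ^+ 2 <= (4 * (d + e) ^+ 2 - 4 * d ^+ 2)%:C.
  move=> e0 [fx xd] [fy yd].
  have sqr_lt (v : V) : `|v| < (d + e)%:C -> `|v| ^+ 2 <= (d + e)%:C ^+ 2.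
    move=> vd; rewrite lerXn2r// ?nnegrE ?(ltW vd)//.
    by rewrite (le_trans _ (ltW vd)).
  have xy2 : (4 * d ^+ 2)%:C <= `|x + y| ^+ 2.
    have : d%:C <= `|2^-1 *: (x + y)|.
      by apply: d_le; rewrite linearZ linearD /= fx fy; apply: mulVf.
    rewrite normrZ ger0_norm ?invr_ge0// ler_pdivlMl// => h.
    rewrite (_ : 4 * d ^+ 2 = (2 * d) ^+ 2); last by ring.
    rewrite rmorphXn/= rmorphM/= rmorph_nat lerXn2r// ?nnegrE//.
    by rewrite mulr_ge0// ler0c.
  rewrite -[X in X <= _](addrK (`|x + y| ^+ 2)) parallelogram.
  rewrite rmorphB/= lerB//.
  rewrite (_ : 4 * _ = 2 * (d + e) ^+ 2 + 2 * (d + e) ^+ 2); last by ring.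
  by rewrite rmorphD/= !rmorphM/= !rmorph_nat lerD// ler_wpM2l//; apply: sqr_lt.
have cF : cvg F.
  apply/cauchy_cvgP/cauchy_exP => eps eps0.
  have [r r0 ->] := complex_gt0P _ eps0.
  (* As e1 <= 1, the bound 8 d e1 + 4 e1^2 is at most (8d + 4) e1, strictly below (8d + 5) e1 <=
     r^2. *)
  pose e1 := Num.min 1 (r ^+ 2 / (8 * d + 5)).
  have e10 : 0 < e1 by rewrite lt_min ltr01 divr_gt0 ?exprn_gt0//; nra.
  have [x Bx] := B0 _ e10; exists x; exists e1 => // y By.
  rewrite -ball_normE /=.
  rewrite -(@ltr_pXn2r _ 2)// ?nnegrE ?ler0c ?(ltW r0)//.
  apply: le_lt_trans (close _ _ _ e10 Bx By) _.
  rewrite -rmorphXn/= ltcR.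
  have e11 : e1 <= 1 by rewrite ge_min lexx.
  have : e1 <= r ^+ 2 / (8 * d + 5) by rewrite ge_min lexx orbT.
  rewrite ler_pdivlMr; last by nra.
  nra.
have [z Fz] : exists z, F --> z by exact/cvg_ex.
have near_z (e e' : R) : 0 < e -> 0 < e' -> exists2 y, B e y & `|z - y| < e'%:C.
  move=> e0 e'0.
  have e'C : 0 < e'%:C by rewrite ltcR.
  have [y [By zy]] : (B e `&` ball z e'%:C) !=set0.
    apply: (@filter_ex _ F); apply: filterI; first by exists e.
    exact: Fz (nbhsx_ballx _ _ e'C).
  by exists y => //; rewrite -ball_normE in zy.
exists z.
  apply/eqP; rewrite -subr_eq0 -normr_le0; apply: le_epsilon_complex => e e0.
  (* For [y] in the hyperplane near [z], [f z - 1] is [f (z - y)]. The constant [|C| + 1] is a bound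
     for [f] by which one may divide. *)
  have C1 : 0 < `|C| + 1 by rewrite ltr_wpDl.
  have [y [fy _] zy] := near_z 1 (e / (`|C| + 1)) ltr01 (divr_gt0 e0 C1).
  rewrite add0r -fy -linearB (le_trans (fC _))//.
  apply: (@le_trans _ _ ((`|C| + 1)%:C * `|z - y|)).
    by rewrite ler_wpM2r// lecR ler_wpDr// ler_norm.
  apply: le_trans (ler_wpM2l _ (ltW zy)) _; first by rewrite ler0c ltW.
  by rewrite -rmorphM/= mulrC divfK// gt_eqF.
move=> x /d_le; apply: le_trans; apply: le_epsilon_complex => e e0.
have e20 : 0 < e / 2 by rewrite divr_gt0.
have [y [_ yd] zy] := near_z _ _ e20 e20.
rewrite -(subrK y z) (le_trans (ler_normD _ _))//.
apply: le_trans (lerD (ltW zy) (ltW yd)) _.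
by rewrite -!rmorphD/= lecR; lra.
Qed.

(** The vector [z] of least norm with [f z = 1] is orthogonal to the kernel of [f]. As
    [x - f x *: z] lies in that kernel, [inner x z = f x * inner z z], and [z] divided by
    [inner z z] represents [f]. *)
Lemma riesz_representation (f : {linear V -> R[i]^o}) (C : R) :
  (forall x, `|f x| <= C%:C * `|x|) -> exists z, forall x, f x = inner x z.
Proof.
move=> fC; have [f0|] := pselect (forall x, f x = 0).
  by exists 0 => x; rewrite f0 linear0r.
move=> /existsNP[x0 /eqP fx0].
have fx1 : f ((f x0)^-1 *: x0) = 1 by rewrite linearZ; apply: mulVf.
have [z fz zmin] := minimal_norm f C _ fC fx1.
have z0 : z != 0.
  apply/eqP => z0; move: fz; rewrite z0 linear0 => /esym/eqP.
  by rewrite oner_eq0.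
have zz0 : inner z z != 0 by rewrite dnorm_eq0.
(* Subtracting from [z] its projection onto [h] keeps the value 1 of [f] and would lower the norm if
   [inner z h] were nonzero. *)
have ker_orth h : f h = 0 -> inner z h = 0.
  move=> fh; have [->|h0] := eqVneq h 0; first by rewrite linear0r.
  have /zmin : f (z - (inner z h / inner h h) *: h) = 1.
    by rewrite linearB linearZ /= fh scaler0 subr0.
  rewrite -(@ler_pXn2r _ 2)// ?nnegrE// sqr_norm_sub_proj// lerDl oppr_ge0.
  rewrite ler_pdivrMr ?mul0r ?exprn_gt0 ?normr_gt0// => zh.
  by apply/eqP; rewrite -normr_eq0 -sqrf_eq0 eq_le zh exprn_ge0.
exists ((inner z z)^-1 *: z) => x.
have : inner z (x - f x *: z) = 0.
  apply: ker_orth.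
  by rewrite linearB linearZ /= fz -[f x *: 1]/(f x * 1) mulr1 subrr.
rewrite innerBr innerZr => /eqP; rewrite subr_eq0 => /eqP zx.
rewrite innerZr [inner x z]innerC zx rmorphM/= conjCK fmorphV/= -innerC.
by rewrite mulrC mulfK.
Qed.

End Riesz.

(** * Operators from bounded sesquilinear forms; limits of bounded functions along ultrafilters *)

Section Forms.
Local Open Scope complex_scope.
Context {R : realType}.

Lemma bounded_form_operator {V : hilbertType R} (B : V -> V -> R[i]) (C : R) :
  (forall y, scalar (B^~ y)) ->
  (forall x a y z, B x (a *: y + z) = Num.conj a * B x y + B x z) ->
  (forall x y, `|B x y| <= C%:C * `|x| * `|y|) ->
  exists T : 'B(V), forall x y, inner (T x) y = B x y.
Proof.
move=> Bl Br BC.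
have /choice[T TB] x : exists z, forall y, inner z y = B x y.
  (* [B x] is conjugate-linear, so its conjugate is the functional to represent. *)
  have fl : linear (fun y => Num.conj (B x y) : R[i]^o).
    by move=> a y z; rewrite Br rmorphD rmorphM/= conjCK.
  pose f : {linear V -> R[i]^o} :=
    HB.pack (fun y => Num.conj (B x y) : R[i]^o)
      (GRing.isLinear.Build _ _ _ _ _ fl).
  have [y|z fz] := riesz_representation f (C * complex.Re `|x|).
    by rewrite norm_conjC rmorphM/= complexRe_norm BC.
  by exists z => y; rewrite innerC -fz /= conjCK.
have Tlin : linear T.
  by move=> a x y; apply: inner_injl => z; rewrite innerDl innerZl !TB Bl.
have TC x : `|T x| <= `|C|%:C * `|x|.
  (* Taking [y = T x] in the bound for [B] gives the square of the norm of [T x]; one factor is then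
     cancelled. *)
  have [->|Tx0] := eqVneq (T x) 0; first by rewrite normr0 mulr_ge0// ler0c.
  have Txp : 0 < `|T x| by rewrite normr_gt0.
  rewrite -(ler_pM2r Txp) -expr2 sqr_normE TB.
  rewrite (le_trans (y := `|B x (T x)|))//.
    by rewrite real_ler_norm// -TB ger0_real.
  by rewrite (le_trans (BC _ _))// !ler_wpM2r// lecR ler_norm.
have bT : T \in @bounded_operator R V V.
  by apply: mem_set; split => //; exists `|C|%:C.
by exists (Bop bT) => x y; rewrite TB.
Qed.

(** Compactness of [-C, C] gives a cluster point, and an ultrafilter converges to each of its
    cluster points: the preimage of a neighbourhood or its complement belongs to [F], and the latter
    is excluded by clustering. *)
Lemma bounded_ultra_cvgr {T : Type} (F : set_system T) (g : T -> R) (C : R) :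
  UltraFilter F -> (forall t, `|g t| <= C) -> exists l : R, g @ F --> l.
Proof.
move=> FU gC; have FP := @ultra_proper _ F FU.
have [p [_ Fp]] : `[-C, C] `&` cluster (g @ F) !=set0.
  apply: segment_compact; apply: (@filterS _ F _ setT _ _ filterT) => t _.
  by rewrite /= in_itv/= -ler_norml.
exists p => A pA; have [//|FnA] := in_ultra_setVsetC (g @^-1` A) FU.
by have [q []] := Fp (~` A) A FnA pA.
Qed.

Lemma bounded_ultra_cvgc {T : Type} (F : set_system T) (g : T -> R[i]) (C : R) :
  UltraFilter F -> (forall t, `|g t| <= C%:C) ->
  exists l : R[i], g @ F --> (l : R[i]^o).
Proof.
move=> FU gC; have FP := @ultra_proper _ F FU.
have [|a Fa] := bounded_ultra_cvgr F (fun t => complex.Re (g t)) C FU.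
  by move=> t; rewrite -lecR (le_trans (normc_ge_Re _)).
have [|b Fb] := bounded_ultra_cvgr F (fun t => complex.Im (g t)) C FU.
  move=> t; rewrite -lecR (le_trans _ (gC t))//.
  (* The imaginary part is, up to sign, the real part after multiplication by i. *)
  have := normc_ge_Re (g t * 'i); rewrite ReiNIm normrN normrM.
  by rewrite [`|'i|]normc_def /= expr0n expr1n add0r sqrtr1 mulr1.
exists (a +i* b); apply/(@cvgrPdist_lt R[i] R[i]^o) => _ /complex_gt0P[e e0 ->].
have e20 : 0 < e / 2 by rewrite divr_gt0.
move: Fa Fb => /cvgrPdist_lt/(_ _ e20) Fa /cvgrPdist_lt/(_ _ e20) Fb.
apply: filterS2 Fa Fb => t /= at_ bt.
apply: le_lt_trans (normc_le_Re_Im _) _.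
rewrite -rmorphD ltcR [e]splitr ltrD//.
  by move: at_; case: (g t).
by move: bt; case: (g t).
Qed.

End Forms.

(** * Adjoints and unitary operators *)

Section Adjoints.
Context {R : realType}.
Implicit Types H K L : hilbertType R.

(** Inner products separate vectors, so the operator picked by [xget] can only be [S]; this is how
    an adjoint is computed. *)
Lemma adjP H K (T : 'B(H, K)) (S : 'B(K, H)) :
  (forall x y, inner (T x) y = inner x (S y)) -> T^† = S.
Proof.
move=> TS; have : [set S : 'B(K, H) |
    forall x y, inner (T x) y = inner x (S y)] T^†.
  exact: xgetPex (ex_intro _ S TS).
move=> TT; apply: bop_ext => y; apply: inner_injr => x.
by rewrite -TS -TT.
Qed.

Lemma bid_eq0 H : bid H = 0 -> forall x : H, x = 0.
Proof. by move=> H0 x; have := congr1 (fun T : 'B(H) => T x) H0. Qed.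

(* If u had no adjoint, then u^† would be the default value 0 and u^† ∘ u = 1
   would force H = 0; hence Riesz representation is not needed here. *)
Lemma unitary_inner H K (u : 'B(H, K)) : unitary_operator u ->
  forall x y, inner (u x) y = inner x (u^† y).
Proof.
move=> [uu uu']; rewrite /adj; case: xgetP => [S _ //|noadj] x y.
have : u^† = 0 by apply: xgetPN.
move=> u0; rewrite u0 in uu.
have /bid_eq0 H0 : bid H = 0.
  by rewrite -uu; apply: bop_ext.
by rewrite (H0 x) linear0 !linear0l.
Qed.

Lemma unitary_innerr H K (u : 'B(H, K)) : unitary_operator u ->
  forall x y, inner (u^† y) x = inner y (u x).
Proof. by move=> uu x y; rewrite innerC -unitary_inner// -innerC. Qed.

Lemma unitaryK H K (u : 'B(H, K)) : unitary_operator u -> cancel u u^†.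
Proof. by move=> [uu _] x; have := congr1 (fun T : 'B(H) => T x) uu. Qed.

Lemma unitaryVK H K (u : 'B(H, K)) : unitary_operator u -> cancel u^† u.
Proof. by move=> [_ uu] x; have := congr1 (fun T : 'B(K) => T x) uu. Qed.

Lemma unitary_norm H K (u : 'B(H, K)) : unitary_operator u ->
  forall x, `|u x| = `|x|.
Proof.
move=> uu x; apply/eqP; rewrite -(@eqrXn2 _ 2)//.
by rewrite !sqr_normE unitary_inner// unitaryK.
Qed.

Lemma unitary_normV H K (u : 'B(H, K)) : unitary_operator u ->
  forall x, `|u^† x| = `|x|.
Proof. by move=> uu x; rewrite -(unitary_norm _ _ _ uu) unitaryVK. Qed.

Lemma adj_comp_unitaryV H K (u v : 'B(H, K)) :
  unitary_operator u -> unitary_operator v -> (u ∘ v^†)^† = v ∘ u^†.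
Proof.
by move=> uu vv; apply: adjP => x y; rewrite /= unitary_inner// unitary_innerr.
Qed.

Lemma comp_unitaryV H K (u v : 'B(H, K)) :
  unitary_operator u -> unitary_operator v -> unitary_operator (u ∘ v^†).
Proof.
move=> uu vv; split; rewrite adj_comp_unitaryV//; apply: bop_ext => x /=.
  by rewrite unitaryK// unitaryVK.
by rewrite unitaryK// unitaryVK.
Qed.

End Adjoints.

(** * Ultrafilters and limits of complex functions *)

(** If [E] were not in [F], the restriction of [F] to the complement of [E] would be proper, and an
    ultrafilter finer than it would contain both [E] and its complement. *)
Lemma ultra_eventually {T : Type} (F : set_system T) (E : set T) : Filter F ->
  (forall U, UltraFilter U -> F `<=` U -> U E) -> F E.
Proof.
move=> FF FE; apply: contrapT => nFE.
have WF : ProperFilter (within (~` E) F).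
  split; last exact: within_filter.
  by rewrite /within/= => FE0; apply: nFE; apply: filterS FE0 => t /contrapT.
have [U [UU WU]] := ultraFilterLemma WF.
have UE : U E.
  by apply: FE => // A FA; apply: WU; exact: (@cvg_within _ F FF (~` E) A FA).
have [t [Et nEt]] := filter_ex (filterI UE (WU _ (withinT (~` E) FF))).
exact: nEt.
Qed.

Section ComplexLimits.
Context {R : realType} {T : Type} (F : set_system T) {FF : ProperFilter F}.
Implicit Types f g : T -> R[i].

Lemma cvgc_unique f (a b : R[i]) :
  f @ F --> (a : R[i]^o) -> f @ F --> (b : R[i]^o) -> a = b.
Proof. exact: (cvg_unique (@norm_hausdorff _ R[i]^o)). Qed.

Lemma cvgc_lin f g (k a b : R[i]) :
  f @ F --> (a : R[i]^o) -> g @ F --> (b : R[i]^o) ->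
  (fun t => k * f t + g t) @ F --> (k * a + b : R[i]^o).
Proof.
move=> fa gb.
exact: (@cvgD _ R[i]^o T F _ (fun t => k * f t) g _ _
  (@cvgMl_tmp R[i] T F _ f k a fa) gb).
Qed.

(** [f] is its own modulus, so [a] equals its modulus by uniqueness of limits; reality and sign of
    [a] follow together. *)
Lemma cvgc_ge0 f (a : R[i]) :
  (forall t, 0 <= f t) -> f @ F --> (a : R[i]^o) -> 0 <= a.
Proof.
move=> f0 fa; have : (fun t => `|f t|) @ F --> (`|a| : R[i]^o).
  exact: (@cvg_norm _ R[i]^o T F _ f a fa).
rewrite (_ : (fun t => _) = f); last by apply/funext => t; rewrite ger0_norm.
by move=> /(cvgc_unique _ _ _ fa) ->.
Qed.

Lemma cvgc_sum (I : finType) (f : I -> T -> R[i]) (a : I -> R[i]) :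
  (forall i, f i @ F --> (a i : R[i]^o)) ->
  (fun t => \sum_i f i t) @ F --> (\sum_i a i : R[i]^o).
Proof. by move=> fa; apply: (@cvg_big R[i]^o) => //; exact: add_continuous. Qed.

End ComplexLimits.

(** * Conjugation by unitaries and point-weak limits of ucp maps *)

Section Compressions.
Local Open Scope complex_scope.
Context {R : realType}.
Implicit Types H K L : hilbertType R.

Lemma compression_inner H L (v : 'B(L, H)) (t : 'B(H)) x y :
  unitary_operator v -> inner ((v^† ∘ t ∘ v) x) y = inner (t (v x)) (v y).
Proof. by move=> vv; rewrite /= unitary_innerr. Qed.

(** The bound does not depend on [v], so it holds along a whole net of unitaries, as limits along an
    ultrafilter require. *)
Lemma compression_inner_le H L (v : 'B(L, H)) (t : 'B(H)) x y :
  unitary_operator v ->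
  `|inner ((v^† ∘ t ∘ v) x) y| <= (opnorm t)%:C * `|x| * `|y|.
Proof.
move=> vv; rewrite compression_inner// (le_trans (cauchy_schwarz _ _))//.
rewrite -(unitary_norm _ _ _ vv x) -(unitary_norm _ _ _ vv y).
by rewrite ler_wpM2r// opnormP.
Qed.

Lemma compression_ucp H K L (A : set 'B(H)) (psi : 'B(H) -> 'B(K))
    (v : 'B(L, K)) :
  unitary_operator v -> ucp A psi -> ucp A (fun t => v^† ∘ psi t ∘ v).
Proof.
move=> vv psiA; split.
- move=> k S T AS AT; apply: bop_ext => x.
  by rewrite /= (ucp_linear psiA)// linearP.
- by apply: bop_ext => x; rewrite /= (ucp_unital psiA)/= unitaryK.
(* Positivity of the conjugated matrix at the vectors [x i] is that of the original one at
   [v (x i)]. *)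
move=> n a Aa a0 x; have := ucp_cp psiA Aa a0 (fun i => v (x i)).
congr (0 <= _); apply: eq_bigr => i _; apply: eq_bigr => j _.
by rewrite !mxE compression_inner.
Qed.

(** Weak operator compactness of bounded sets: the matrix coefficients converge along [U], and their
    limits form a bounded sesquilinear form, hence come from an operator. *)
Lemma ultralimit_operator {T : Type} (U : set_system T) H (a : T -> 'B(H))
    (C : R) : UltraFilter U ->
  (forall b x y, `|inner (a b x) y| <= C%:C * `|x| * `|y|) ->
  exists S : 'B(H), forall x y,
    (fun b => inner (a b x) y) @ U --> (inner (S x) y : R[i]^o).
Proof.
move=> UU aC; have UP := @ultra_proper _ U UU.
have /choice[l lP] (p : H * H) : exists l : R[i],
    (fun b => inner (a b p.1) p.2) @ U --> (l : R[i]^o).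
  apply: (bounded_ultra_cvgc _ _ (C * complex.Re `|p.1| * complex.Re `|p.2|) UU).
  by move=> b; rewrite !rmorphM/= !complexRe_norm.
have [|x k y z|x y|S Sl] := bounded_form_operator (fun x y => l (x, y)) C.
- move=> y k x z; apply: cvgc_unique (lP _) _ => /=.
  rewrite (_ : (fun b => _) =
    (fun b => k * inner (a b x) y + inner (a b z) y)); last first.
    by apply/funext => b; rewrite linearP innerDl innerZl.
  by apply: cvgc_lin; [exact: lP (x, y)|exact: lP (z, y)].
- apply: cvgc_unique (lP _) _ => /=.
  rewrite (_ : (fun b => _) =
    (fun b => Num.conj k * inner (a b x) y + inner (a b x) z)); last first.
    by apply/funext => b; rewrite innerDr innerZr.
  by apply: cvgc_lin; [exact: lP (x, y)|exact: lP (x, z)].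
- rewrite -subr_ge0; apply: (@cvgc_ge0 _ _ U _
      (fun b => C%:C * `|x| * `|y| - `|inner (a b x) y|)).
    by move=> b; rewrite subr_ge0.
  exact: (@cvgB _ R[i]^o _ _ _ _ _ _ _ (cvg_cst _)
    (@cvg_norm _ R[i]^o _ _ _ _ _ (lP (x, y)))).
by exists S => x y; rewrite Sl; exact: lP (x, y).
Qed.

(** Each condition in [ucp] is an equality or inequality between finite linear combinations of
    matrix coefficients, so it survives their limits. *)
Lemma ultralimit_ucp {T : Type} (U : set_system T) H K (A : set 'B(H))
    (phi : T -> 'B(H) -> 'B(K)) (phi' : 'B(H) -> 'B(K)) : ProperFilter U ->
  (forall b, ucp A (phi b)) ->
  (forall t x y,
    (fun b => inner (phi b t x) y) @ U --> (inner (phi' t x) y : R[i]^o)) ->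
  ucp A phi'.
Proof.
move=> UP phiA phi'P; split.
- move=> k S T' AS AT; apply: bop_ext => x; apply: inner_injl => y.
  apply: cvgc_unique (phi'P _ _ _) _.
  rewrite (_ : (fun b => _) =
      (fun b => k * inner (phi b S x) y + inner (phi b T' x) y)); last first.
    by apply/funext => b; rewrite (ucp_linear (phiA b))// innerDl innerZl.
  by rewrite /= innerDl innerZl; apply: cvgc_lin; exact: phi'P.
- apply: bop_ext => x; apply: inner_injl => y.
  apply: cvgc_unique (phi'P _ _ _) _.
  rewrite (_ : (fun b => _) = cst (inner (bid K x) y)).
    exact: (@cvg_cst R[i]^o).
  by apply/funext => b; rewrite (ucp_unital (phiA b)).
move=> n a Aa a0 x.
apply: (@cvgc_ge0 _ _ U _
    (fun b => \sum_i \sum_j inner (phi b (a i j) (x j)) (x i))).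
  move=> b; have := ucp_cp (phiA b) Aa a0 x.
  by under eq_bigr do under eq_bigr do rewrite mxE.
under [X in _ --> X]eq_bigr do under eq_bigr do rewrite mxE.
apply: cvgc_sum => i; apply: cvgc_sum => j; exact: phi'P.
Qed.

End Compressions.

(** * Weak convergence of nets of conjugated maps *)

Section Nets.
Local Open Scope complex_scope.
Context {R : realType}.
Implicit Types H K L : hilbertType R.

Lemma uep_compression_WOT_cvg H K L (M : set 'B(H)) (sigma : 'B(H) -> 'B(L))
    (psi : 'B(H) -> 'B(K)) (D : directedType) (v : D -> 'B(L, K)) :
  unique_extension_property M sigma -> ucp (Cstar M) psi ->
  (forall b, unitary_operator (v b)) ->
  (forall m, M m -> WOT_cvg (fun b => (v b)^† ∘ psi m ∘ v b) (sigma m)) ->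
  forall t, Cstar M t -> WOT_cvg (fun b => (v b)^† ∘ psi t ∘ v b) (sigma t).
Proof.
move=> uep psiM vu vM t Mt x y E Ey.
apply: (@ultra_eventually D (tails D)
  ((fun b => inner (((v b)^† ∘ psi t ∘ v b) x) y) @^-1` E)) => U UU DU.
have UP := @ultra_proper _ U UU.
(* [phi] is the point-weak limit along [U], chosen for every operator [s], in [Cstar M] or not. *)
have /choice[phi phiP] s : exists S : 'B(L), forall x y,
    (fun b => inner (((v b)^† ∘ psi s ∘ v b) x) y) @ U -->
      (inner (S x) y : R[i]^o).
  apply: (ultralimit_operator _ _ _ (opnorm (psi s)) UU) => b x' y'.
  exact: compression_inner_le.
have phiM : ucp (Cstar M) phi.
  apply: ultralimit_ucp phiP => b; exact: compression_ucp.
have phi_sigma : {in M, phi =1 sigma}.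
  move=> m /set_mem Mm; apply: bop_ext => x'; apply: inner_injl => y'.
  (* [U] is finer than the tails, so the limit along the net is also the limit along [U]. *)
  apply: cvgc_unique (phiP _ _ _) _ => B /(vM m Mm x' y'); exact: DU.
have := phiP t x y; rewrite (uep _ phiM phi_sigma) ?mem_set//.
by move=> /(_ _ Ey).
Qed.

(** Norm convergence is uniform over vectors of bounded norm. This permits test vectors that vary
    with the index, such as v_b^* x. *)
Lemma norm_cvg_near_inner H D (T : directed_sort D -> 'B(H)) (S : 'B(H))
    (C e : R[i]) : 0 <= C -> 0 < e ->
  `|T b - S| @[b --> tails D] --> (0 : R[i]^o) ->
  \forall b \near tails D, forall x y, `|x| * `|y| <= C ->
    `|inner (T b x) y - inner (S x) y| < e.
Proof.
move=> C0 e0; have C1 : 0 < C + 1 by rewrite ltr_wpDl.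
move=> /(@cvgrPdist_lt _ R[i]^o)/(_ _ (divr_gt0 e0 C1)); apply: filterS => b.
rewrite sub0r normrN normr_id ltr_pdivlMr// => Tb x y xyC.
rewrite -innerBl; apply: le_lt_trans Tb.
rewrite (le_trans (cauchy_schwarz ((T b - S) x) y))//.
rewrite (le_trans (ler_wpM2r _ (opnormP _ _)))// -bop_normE -mulrA.
by rewrite ler_wpM2l// (le_trans xyC)// lerDl.
Qed.

Lemma norm_cvg_WOT_cvg H D (T : directed_sort D -> 'B(H)) (S : 'B(H)) :
  `|T b - S| @[b --> tails D] --> (0 : R[i]^o) -> WOT_cvg T S.
Proof.
move=> TS x y; apply/(@cvgrPdist_lt _ R[i]^o) => e e0.
have xy0 : 0 <= `|x| * `|y| by rewrite mulr_ge0.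
apply: filterS (norm_cvg_near_inner _ _ _ _ _ _ xy0 e0 TS) => b.
by rewrite distrC; exact.
Qed.

Lemma filter_ex_all_seq {T I : Type} (F : set_system T) (s : seq I)
    (P : I -> set T) : ProperFilter F -> (forall i, F (P i)) ->
  exists t, forall i, List.In i s -> P i t.
Proof.
move=> FF FP; suff : F [set t | forall i, List.In i s -> P i t].
  exact: filter_ex.
elim: s => [|i s IH]; first by apply: filterS filterT => t _ i [].
by apply: filterS2 (FP i) IH => t it st j [<-//|]; exact: st.
Qed.

(** The net is indexed by pairs of a finite list of triples (t, (x, y)) and a number n, ordered by
    inclusion and size; at such an index the error on the list is below 1 / (n + 1). *)
Lemma WOT_net_of_finite_approx H K (A : set 'B(H)) (psi pi : 'B(H) -> 'B(K)) :
  (forall (s : seq ('B(H) * (K * K))) (e : R), 0 < e ->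
    exists2 u : 'B(K), unitary_operator u & forall p, List.In p s -> A p.1 ->
      `|inner ((u^† ∘ psi p.1 ∘ u) p.2.1) p.2.2 -
        inner (pi p.1 p.2.1) p.2.2| < e%:C) ->
  exists (D : directedType) (u : D -> 'B(K)),
    (forall b, unitary_operator (u b)) /\
    forall t, A t -> WOT_cvg (fun b => (u b)^† ∘ psi t ∘ u b) (pi t).
Proof.
move=> approx.
pose I : Type := (seq ('B(H) * (K * K)) * nat)%type.
pose le (a b : I) := List.incl a.1 b.1 /\ (a.2 <= b.2)%N.
have le_refl b : le b b by split => // p.
have le_trans a b c : le a b -> le b c -> le a c.
  by move=> [ab ab'] [bc bc']; split; [move=> p /ab/bc|exact: leq_trans bc'].
have le_ub a b : exists c, le a c /\ le b c.
  exists (a.1 ++ b.1, maxn a.2 b.2).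
  split; split; rewrite /= ?leq_maxl ?leq_maxr// => p;
    rewrite List.in_app_iff; tauto.
pose D := DirectedType le_refl le_trans le_ub
  (inhabits ([::], 0%N) : inhabited I).
have /choice[u uP] (b : D) : exists u : 'B(K), unitary_operator u /\
    forall p, List.In p b.1 -> A p.1 ->
      `|inner ((u^† ∘ psi p.1 ∘ u) p.2.1) p.2.2 -
        inner (pi p.1 p.2.1) p.2.2| < (b.2.+1%:R^-1)%:C.
  have [|u uu us] := approx b.1 b.2.+1%:R^-1; first by rewrite invr_gt0.
  by exists u.
exists D, u; split => [b|t At x y]; first by have [] := uP b.
apply/(@cvgrPdist_lt _ R[i]^o) => _ /complex_gt0P[e e0 ->].
(* From this index on, the triple is in the list and n + 1 exceeds 1 / e. *)
exists ([:: (t, (x, y))], Num.truncn e^-1) => b [tb nb].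
rewrite distrC; have [_ /(_ (t, (x, y))) ub] := uP b.
apply: lt_trans (ub _ At) _; first by apply: tb; left.
rewrite ltcR invf_plt ?posrE//.
apply: lt_le_trans (truncnS_gt _) _.
by rewrite ler_nat ltnS.
Qed.

End Nets.

(** * Choice of the unitaries v_b v_g^* from the two convergences to sigma *)

Theorem theorem1p1 (R : realType) (H Hpi : hilbertType R) (M : set 'B(H))
    (hM : unital_operator_space M)
    (pi : 'B(H) -> 'B(Hpi)) (hpi : star_representation (Cstar M) pi)
    (hequiv : exists (Hsigma : hilbertType R) (sigma : 'B(H) -> 'B(Hsigma)),
      star_representation (Cstar M) sigma /\
      unique_extension_property M sigma /\
      approx_unitarily_equiv (Cstar M) pi sigma)
    (psi : 'B(H) -> 'B(Hpi)) (hpsi : ucp (Cstar M) psi)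
    (hpsiM : {in M, psi =1 pi}) :
  exists (D : directedType) (u : D -> 'B(Hpi)),
    (forall b, unitary_operator (u b)) /\
    forall t, Cstar M t ->
      WOT_cvg (fun b => (u b)^† ∘ psi t ∘ u b) (pi t).
Proof.
have [L [sigma [_ [uep [D [v [vu vpi]]]]]]] := hequiv.
have pi_sigma t : Cstar M t ->
    WOT_cvg (fun b => (v b)^† ∘ pi t ∘ v b) (sigma t).
  by move=> /vpi; exact: norm_cvg_WOT_cvg.
have psi_sigma : forall t, Cstar M t ->
    WOT_cvg (fun b => (v b)^† ∘ psi t ∘ v b) (sigma t).
  apply: uep_compression_WOT_cvg => // m Mm.
  rewrite hpsiM ?mem_set//; apply: pi_sigma; exact: sub_gen_smallest.
apply: WOT_net_of_finite_approx => s e e0.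
have e20 : 0 < real_complex R (e / 2) by rewrite ltcR divr_gt0.
(* The test vectors v_g^* x and v_g^* y move with g but keep their norms, so the uniform estimate
   applies. *)
have [|g pi_g] := @filter_ex_all_seq D _ (tails D) s (fun p g => Cstar M p.1 ->
    `|inner (sigma p.1 ((v g)^† p.2.1)) ((v g)^† p.2.2) -
      inner (pi p.1 p.2.1) p.2.2| < real_complex R (e / 2)) _.
  move=> -[t [x y]] /=.
  have [At|At] := pselect (Cstar M t); last by apply: filterS filterT.
  have xy0 : 0 <= `|x| * `|y| by rewrite mulr_ge0.
  apply: filterS (norm_cvg_near_inner _ _ _ _ _ _ xy0 e20 (vpi t At)) => g.
  move=> /(_ ((v g)^† x) ((v g)^† y)).
  rewrite !unitary_normV// lexx => /(_ isT).
  by rewrite compression_inner// !unitaryVK// distrC.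
(* With g fixed the test vectors are fixed, and weak convergence is enough to choose b. *)
have [|b psi_b] := @filter_ex_all_seq D _ (tails D) s (fun p b => Cstar M p.1 ->
    `|inner (((v b)^† ∘ psi p.1 ∘ v b) ((v g)^† p.2.1)) ((v g)^† p.2.2) -
      inner (sigma p.1 ((v g)^† p.2.1)) ((v g)^† p.2.2)| <
    real_complex R (e / 2)) _.
  move=> -[t [x y]] /=.
  have [At|At] := pselect (Cstar M t); last by apply: filterS filterT.
  have /(@cvgrPdist_lt _ R[i]^o)/(_ _ e20) :=
    psi_sigma t At ((v g)^† x) ((v g)^† y).
  by apply: filterS => b + _; rewrite distrC.
exists (v b ∘ (v g)^†); first exact: comp_unitaryV.
move=> p ps Ap; rewrite compression_inner; last exact: comp_unitaryV.
(* The coefficient of sigma at v_g^* x, v_g^* y is the midpoint of the triangle inequality; each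
   side contributes e / 2. *)
rewrite -(subrKA (inner (sigma p.1 ((v g)^† p.2.1)) ((v g)^† p.2.2))).
rewrite (le_lt_trans (ler_normD _ _))// [e in X in _ < X]splitr rmorphD ltrD//.
  by have := psi_b p ps Ap; rewrite compression_inner.
exact: pi_g.
Qed.
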